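(* Let $\{|\psi_\lambda\rangle=|\alpha_\lambda\rangle|\beta_\lambda\rangle,p_\lambda\}_{\lambda=1}^3$ with $p_\lambda>0$ be a linearly independent ensemble of two-qubit product states whose span is $\{|\Phi\rangle\}^\perp$ for a unit vector $|\Phi\rangle$. Let $\lambda_{min}(\Phi)$ be the smallest squared Schmidt coefficient of $|\Phi\rangle$. If $$p_i^2\lambda_{min}^2(\Phi)>p_j^2|\langle\psi_i|\psi_j\rangle|^2+p_k^2|\langle\psi_i|\psi_k\rangle|^2$$ for every $i,j,k$ with $\{i,j,k\}=\{1,2,3\}$, then no LOCC measurement attains the optimal minimum-error success probability for the ensemble.
   Context: $\{|\Phi\rangle\}^\perp$ is the orthogonal complement of $|\Phi\rangle$ in $\mathbb{C}^2\otimes\mathbb{C}^2$. The optimal minimum-error success probability of $\{|\psi_i\rangle,p_i\}_{i=1}^n$ is the maximum over $n$-outcome POVMs $\{\Pi_i\}$ of $\sum_ip_i\langle\psi_i|\Pi_i|\psi_i\rangle$. LOCC means measurements implementable by local operations on each qubit and classical communication. *)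

(* Defs.v *)
From HB Require Import structures.
From mathcomp Require Import all_boot all_order all_algebra.
From mathcomp Require Import spectral.
Set Implicit Arguments.
Unset Strict Implicit.
Unset Printing Implicit Defensive.
Import Order.TTheory GRing.Theory Num.Theory.
Local Open Scope ring_scope.
Local Open Scope sesquilinear_scope.

Lemma kron_idx1_proof m p (i : 'I_(m * p)) : (i %/ p < m)%N.
Proof.
move: i; case: p => [|p] i; first by case: i => k; rewrite muln0.
by rewrite ltn_divLR // ltn_ord.
Qed.

Lemma kron_idx2_proof m p (i : 'I_(m * p)) : (i %% p < p)%N.
Proof.
move: i; case: p => [|p] i; first by case: i => k; rewrite muln0.
by rewrite ltn_pmod.
Qed.

Definition kron_idx1 m p (i : 'I_(m * p)) : 'I_m := Ordinal (kron_idx1_proof i).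
Definition kron_idx2 m p (i : 'I_(m * p)) : 'I_p := Ordinal (kron_idx2_proof i).

(* index (a, b) of C^m (x) C^p is a * p + b, as for mxvec_index *)
Definition kronmx (R : nzRingType) m n p q (A : 'M[R]_(m, n)) (B : 'M[R]_(p, q))
  : 'M[R]_(m * p, n * q) :=
  \matrix_(i, j) (A (kron_idx1 i) (kron_idx1 j) * B (kron_idx2 i) (kron_idx2 j)).

Section Quantum.
Variable C : numClosedFieldType.

Definition braket n (u v : 'cV[C]_n) : C := (u ^t* *m v) 0 0.

Definition psd n (A : 'M[C]_n) : Prop := forall v : 'cV[C]_n, 0 <= braket v (A *m v).

Definition is_povm n (P : 'I_n -> 'M[C]_(2 * 2)) : Prop :=
  (forall i, psd (P i)) /\ \sum_(i < n) P i = 1%:M.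

Definition succ_prob n (p : 'I_n -> C) (psi : 'I_n -> 'cV[C]_(2 * 2))
  (P : 'I_n -> 'M[C]_(2 * 2)) : C :=
  \sum_(i < n) p i * braket (psi i) (P i *m psi i).

Definition optimal_povm n p psi (P : 'I_n -> 'M[C]_(2 * 2)) : Prop :=
  is_povm P /\ forall P', is_povm P' -> succ_prob p psi P' <= succ_prob p psi P.

Definition schmidt_decomp (Phi : 'cV[C]_(2 * 2)) (s : 'I_2 -> C) : Prop :=
  exists (e f : 'I_2 -> 'cV[C]_2),
    (forall k l, braket (e k) (e l) = (k == l)%:R) /\
    (forall k l, braket (f k) (f l) = (k == l)%:R) /\
    (forall k, 0 <= s k) /\
    Phi = \sum_(k < 2) s k *: kronmx (e k) (f k).

(* ---------- LOCC protocols (finitely many rounds) ----------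
   Local systems are embedded in C^D (D >= the qubit dimension 2; the qubit is
   the span of the first two basis vectors), which accommodates ancillas and
   dimension-changing local Kraus operators.  A protocol is a finite tree: at
   each node one party (Alice or Bob) applies a local instrument with finitely
   many Kraus operators, broadcasts the outcome, and the protocol continues
   according to that outcome; each leaf announces a final outcome in 'I_n. *)
Inductive locc (D n : nat) : Type :=
| LoccLeaf : 'I_n -> locc D n
| LoccAlice : forall m : nat, ('I_m -> 'M[C]_D) -> ('I_m -> locc D n) -> locc D n
| LoccBob : forall m : nat, ('I_m -> 'M[C]_D) -> ('I_m -> locc D n) -> locc D n.

Fixpoint locc_wf D n (t : locc D n) : Prop :=
  match t with
  | LoccLeaf _ => True
  | LoccAlice m K next =>
      \sum_(r < m) (K r)^t* *m K r = 1%:M /\ forall r, locc_wf (next r)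
  | LoccBob m K next =>
      \sum_(r < m) (K r)^t* *m K r = 1%:M /\ forall r, locc_wf (next r)
  end.

Definition qubit_emb D : 'M[C]_(D, 2) := \matrix_(i, j) ((i : nat) == j)%:R.

(* POVM element for outcome i, given the accumulated local operators A (Alice)
   and B (Bob) along the path so far: sum over leaves labelled i of
   (A_l (x) B_l)^dag (A_l (x) B_l), restricted to the two-qubit input space. *)
Fixpoint locc_effect D n (t : locc D n) (A B : 'M[C]_D) (i : 'I_n)
  : 'M[C]_(2 * 2) :=
  match t with
  | LoccLeaf j =>
      if j == i then
        kronmx ((qubit_emb D)^t* *m (A^t* *m A) *m qubit_emb D)
               ((qubit_emb D)^t* *m (B^t* *m B) *m qubit_emb D)
      else 0
  | LoccAlice m K next => \sum_(r < m) locc_effect (next r) (K r *m A) B i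
  | LoccBob m K next => \sum_(r < m) locc_effect (next r) A (K r *m B) i
  end.

Definition locc_povm D n (t : locc D n) : 'I_n -> 'M[C]_(2 * 2) :=
  fun i => locc_effect t 1%:M 1%:M i.

Definition is_locc_povm n (P : 'I_n -> 'M[C]_(2 * 2)) : Prop :=
  exists D (t : locc D n), (2 <= D)%N /\ locc_wf t /\ locc_povm t = P.

End Quantum.

(* Main.v *)
Require Import Defs.
From HB Require Import structures.
From mathcomp Require Import all_boot all_order all_algebra.
From mathcomp Require Import spectral sesquilinear ring.
Set Implicit Arguments.
Unset Strict Implicit.
Unset Printing Implicit Defensive.
Import Order.TTheory GRing.Theory Num.Theory.
Local Open Scope ring_scope.
Local Open Scope sesquilinear_scope.

(* Let [P] be optimal and [G = sum_i p_i P_i |psi_i><psi_i|].  Optimality makes [G]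
   Hermitian with [G >= p_i |psi_i><psi_i|] and [G P_i = p_i |psi_i><psi_i| P_i].
   Hence the vectors [u_i = P_i psi_i] are orthogonal to one another and to [Phi],
   and [P] discriminates them perfectly.  If [P] is LOCC, the first nontrivial local
   measurement of the protocol must keep the [u_i] orthogonal; for three vectors of
   C^2 (x) C^2 this forces two of them to be product vectors, and then the
   normalized third one, [u_k], has the same concurrence as [Phi], so that
   [|det u_k|^2 = lam (1 - lam)].  On the other hand [u_k] has squared overlap
   [g_k = <psi_k|P_k|psi_k>] with a product vector, so [|det u_k|^2 <= 1 - g_k], and
   the hypothesis on the priors gives [1 - g_k < lam^2 <= lam (1 - lam)]. *)

(** * Positive semidefinite matrices *)

Section Adjoint.
Variable C : numClosedFieldType.

Lemma adjmxM m n p (A : 'M[C]_(m, n)) (B : 'M[C]_(n, p)) :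
  (A *m B)^t* = B^t* *m A^t*.
Proof. by rewrite trmx_mul map_mxM. Qed.

Lemma adjmxD m n (A B : 'M[C]_(m, n)) : (A + B)^t* = A^t* + B^t*.
Proof. by rewrite linearD map_mxD. Qed.

Lemma adjmxN m n (A : 'M[C]_(m, n)) : (- A)^t* = - A^t*.
Proof. by rewrite linearN map_mxN. Qed.

Lemma adjmxZ m n a (A : 'M[C]_(m, n)) : (a *: A)^t* = a^* *: A^t*.
Proof. by rewrite linearZ map_mxZ. Qed.

Lemma adjmx_scalar n (a : C) : (a%:M : 'M_n)^t* = a^*%:M.
Proof. by rewrite tr_scalar_mx map_scalar_mx. Qed.

Lemma adjmx_sum m n I (r : seq I) (P : pred I) (F : I -> 'M[C]_(m, n)) :
  (\sum_(i <- r | P i) F i)^t* = \sum_(i <- r | P i) (F i)^t*.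
Proof. by rewrite linear_sum map_mx_sum. Qed.

Section Braket.
Variable n : nat.
Implicit Types (u v w : 'cV[C]_n) (A : 'M[C]_n).

Lemma braketE u v : braket u v = \sum_i (u i 0)^* * v i 0.
Proof. by rewrite /braket mxE; apply: eq_bigr => i _; rewrite !mxE. Qed.

Lemma braketDr u v w : braket u (v + w) = braket u v + braket u w.
Proof. by rewrite /braket mulmxDr mxE. Qed.

Lemma braketNr u v : braket u (- v) = - braket u v.
Proof. by rewrite /braket mulmxN mxE. Qed.

Lemma braketBr u v w : braket u (v - w) = braket u v - braket u w.
Proof. by rewrite braketDr braketNr. Qed.

Lemma braketZr a u v : braket u (a *: v) = a * braket u v.
Proof. by rewrite /braket -scalemxAr mxE. Qed.

Lemma braket_sumr u I (r : seq I) (P : pred I) (F : I -> 'cV[C]_n) :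
  braket u (\sum_(i <- r | P i) F i) = \sum_(i <- r | P i) braket u (F i).
Proof. by rewrite /braket mulmx_sumr summxE. Qed.

Lemma braket0r u : braket u 0 = 0.
Proof. by rewrite /braket mulmx0 mxE. Qed.

Lemma braketC u v : (braket u v)^* = braket v u.
Proof.
by rewrite !braketE rmorph_sum; apply: eq_bigr => i _;
  rewrite rmorphM /= conjCK mulrC.
Qed.

Lemma braketDl u v w : braket (v + w) u = braket v u + braket w u.
Proof. by rewrite -braketC braketDr rmorphD /= !braketC. Qed.

Lemma braketNl u v : braket (- v) u = - braket v u.
Proof. by rewrite -braketC braketNr rmorphN /= braketC. Qed.

Lemma braketBl u v w : braket (v - w) u = braket v u - braket w u.
Proof. by rewrite braketDl braketNl. Qed.

Lemma braketZl a u v : braket (a *: v) u = a^* * braket v u.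
Proof. by rewrite -braketC braketZr rmorphM /= braketC. Qed.

Lemma braket0l u : braket 0 u = 0.
Proof. by rewrite -braketC braket0r conjC0. Qed.

Lemma braket_dotmx u v : braket u v = dotmx v^T u^T.
Proof.
by rewrite dotmxE braketE !mxE; apply: eq_bigr => i _; rewrite !mxE mulrC.
Qed.

Lemma braket_ge0 u : 0 <= braket u u.
Proof. by rewrite braketE sumr_ge0 // => i _; rewrite mulrC mul_conjC_ge0. Qed.

Lemma braket_eq0 u : (braket u u == 0) = (u == 0).
Proof.
apply/idP/eqP => [|->]; last by rewrite braket0r.
rewrite braketE psumr_eq0 => [/allP u0|i _]; last by rewrite mulrC mul_conjC_ge0.
apply/matrixP => i j; rewrite ord1 mxE; apply/eqP.
by have := u0 i (mem_index_enum i); rewrite /= mulrC mul_conjC_eq0.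
Qed.

Lemma norm_braketC u v : `|braket u v| = `|braket v u|.
Proof. by rewrite -braketC norm_conjC. Qed.

Lemma braket_CauchySchwarz u v :
  `|braket u v| ^+ 2 <= braket u u * braket v v.
Proof.
by rewrite !braket_dotmx mulrC; exact: (CauchySchwarz (@dotmx C n) v^T u^T).
Qed.

Lemma braket_delta i A j :
  braket (delta_mx i 0) (A *m delta_mx j 0) = A i j.
Proof.
rewrite -colE braketE (bigD1 i) //= big1 => [|k /negPf ki].
  by rewrite !mxE !eqxx /= conjC1 mul1r addr0.
by rewrite !mxE ki /= conjC0 mul0r.
Qed.

End Braket.

Lemma braket_adjl m n (A : 'M[C]_(m, n)) (u : 'cV[C]_m) (v : 'cV[C]_n) :
  braket u (A *m v) = braket (A^t* *m u) v.
Proof. by rewrite /braket adjmxM trmxCK mulmxA. Qed.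

Lemma braket_adjr m n (A : 'M[C]_(n, m)) (u : 'cV[C]_m) (v : 'cV[C]_n) :
  braket (A *m u) v = braket u (A^t* *m v).
Proof. by rewrite braket_adjl trmxCK. Qed.

Lemma outer_mul n (u v w : 'cV[C]_n) : u *m v^t* *m w = braket v w *: u.
Proof.
by rewrite -mulmxA (mx11_scalar (v^t* *m w)) mul_mx_scalar.
Qed.

Section Psd.
Variable n : nat.
Implicit Types (u v : 'cV[C]_n) (A B : 'M[C]_n).

(** [psd] asks only for nonnegative values of the quadratic form; since these are real, polarization
    at [u + v] and [u + 'i *: v] yields Hermitian symmetry. *)
Lemma psd_adj A : psd A -> A^t* = A.
Proof.
move=> psdA; have real v : (braket v (A *m v))^* = braket v (A *m v).
  exact: geC0_conj (psdA v).
have sesq u v : (braket u (A *m v))^* = braket v (A *m u).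
  move: (real (u + v)) (real (u + 'i *: v)).
  rewrite !mulmxDr -!scalemxAr !braketDr !braketDl !braketZr !braketZl.
  rewrite !rmorphD !rmorphM /= !real !conjCi ?conjCK ?rmorphN /= ?conjCi ?opprK.
  set x := braket u (A *m v); set y := braket v (A *m u).
  set a := braket u _; set b := braket v _ => /eqP E2 /eqP E1.
  have i0 : 'i != 0 :> C := neq0Ci C.
  have i2 : 'i ^+ 2 = -1 :> C := sqrCi C.
  apply/eqP; rewrite -subr_eq0.
  (* ['i] times the identity from [u + v], minus the one from [u + 'i *: v]. *)
  have: 2%:R * 'i * (x^* - y) == 0.
    rewrite -subr_eq0 in E1; rewrite -subr_eq0 in E2.
    apply/eqP; transitivity ('i * 0 - 0 : C); last by rewrite mulr0 subr0.
    by rewrite -{1}(eqP E2) -(eqP E1); ring.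
  by rewrite !mulf_eq0 pnatr_eq0 (negPf i0).
apply/matrixP => i j; rewrite -[LHS]braket_delta -[RHS]braket_delta.
by rewrite -sesq braketC braket_adjr.
Qed.

(** Unitary diagonalization, then square roots of the nonnegative eigenvalues. *)
Lemma psd_gram A : psd A -> exists B : 'M[C]_n, A = B^t* *m B.
Proof.
move=> psdA; have herm := psd_adj psdA.
have /orthomx_spectralP : A \is normalmx by apply/normalmxP; rewrite herm.
set P := spectralmx A; set d := spectral_diag A => defA.
have uP : P \is unitarymx by exact: spectral_unitarymx.
rewrite (invmx_unitary uP) in defA.
have PP : P *m P^t* = 1%:M by exact/unitarymxP.
have d_ge0 i : 0 <= d 0 i.
  have := psdA (P^t* *m delta_mx i 0); rewrite braket_adjr trmxCK.
  rewrite defA !mulmxA PP mul1mx -(mulmxA _ P) PP mulmx1 braket_delta.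
  by rewrite mxE eqxx.
exists (diag_mx (map_mx sqrtC d) *m P).
have -> : A = P^t* *m ((diag_mx (map_mx sqrtC d))^t* *m diag_mx (map_mx sqrtC d)) *m P.
  rewrite {1}defA; congr (_ *m _ *m _).
  rewrite tr_diag_mx map_diag_mx mulmx_diag; congr diag_mx; apply/rowP => i.
  by rewrite !mxE /= geC0_conj ?sqrtC_ge0 ?d_ge0 // -expr2 sqrtCK.
by rewrite adjmxM !mulmxA.
Qed.

Lemma gram_psd m (B : 'M[C]_(m, n)) : psd (B^t* *m B).
Proof. by move=> v; rewrite -mulmxA -braket_adjr braket_ge0. Qed.

Lemma psd_CauchySchwarz A u v : psd A ->
  `|braket u (A *m v)| ^+ 2 <= braket u (A *m u) * braket v (A *m v).
Proof.
case/psd_gram => B ->; rewrite -!mulmxA -!braket_adjr.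
exact: braket_CauchySchwarz.
Qed.

Lemma psd_ker A v : psd A -> braket v (A *m v) = 0 -> A *m v = 0.
Proof.
case/psd_gram => B ->; rewrite -!mulmxA -braket_adjr => /eqP.
by rewrite braket_eq0 => /eqP ->; rewrite mulmx0.
Qed.

Lemma psd_sum I (r : seq I) (Q : pred I) (F : I -> 'M[C]_n) :
  (forall i, Q i -> psd (F i)) -> psd (\sum_(i <- r | Q i) F i).
Proof.
by move=> psdF v; rewrite mulmx_suml braket_sumr sumr_ge0 // => i /psdF.
Qed.

Lemma psd_conj A (B : 'M[C]_n) : psd A -> psd (B^t* *m A *m B).
Proof. by move=> psdA v; rewrite -!mulmxA -braket_adjr. Qed.

Lemma mxtrace_gram_mul A (B : 'M[C]_n) :
  \tr (A *m (B^t* *m B)) =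
  \sum_i braket (B^t* *m delta_mx i 0) (A *m (B^t* *m delta_mx i 0)).
Proof.
rewrite mulmxA mxtrace_mulC; apply: eq_bigr => i _.
by rewrite braket_adjr trmxCK !mulmxA braket_delta.
Qed.

Lemma psd_mul_trace_ge0 A B : psd A -> psd B -> 0 <= \tr (A *m B).
Proof.
by move=> psdA /psd_gram[D ->]; rewrite mxtrace_gram_mul sumr_ge0.
Qed.

(** With [B] in Gram form the trace is a sum of nonnegative values of the form of [A]; all of them
    vanish, and [psd_ker] makes [A] kill every column of the left Gram factor. *)
Lemma psd_mul_trace_eq0 A B : psd A -> psd B -> \tr (A *m B) = 0 -> A *m B = 0.
Proof.
move=> psdA /psd_gram[D ->]; rewrite mxtrace_gram_mul => /eqP.
rewrite psumr_eq0 => [/allP AD0|i _]; last exact: psdA.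
rewrite mulmxA [A *m _](_ : _ = 0) ?mul0mx //; apply/matrixP => i j.
have /eqP/(psd_ker psdA) := AD0 j (mem_index_enum _).
by rewrite mulmxA -colE => /matrixP/(_ i 0); rewrite !mxE.
Qed.

End Psd.
End Adjoint.

(** * Optimality conditions for minimum-error discrimination *)

Section Optimality.
Variables (C : numClosedFieldType) (n : nat) (p : 'I_n -> C).
Variables (psi : 'I_n -> 'cV[C]_(2 * 2)) (P : 'I_n -> 'M[C]_(2 * 2)).
Hypotheses (p_ge0 : forall i, 0 <= p i) (optP : optimal_povm p psi P).

Definition lagrange_op : 'M[C]_(2 * 2) :=
  \sum_i p i *: (P i *m psi i *m (psi i)^t*).
Local Notation G := lagrange_op.

Let psdP i : psd (P i). Proof. by case: optP => [[]]. Qed.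
Let sumP : \sum_i P i = 1%:M. Proof. by case: optP => [[]]. Qed.
Let adjP i : (P i)^t* = P i. Proof. exact: psd_adj. Qed.

(** Stands in for letting [e] tend to 0. *)
Lemma real_le0_of_small (X Y q : C) : X \is Num.real -> 0 <= Y -> 0 <= q ->
  (forall e : C, 0 < e -> e * q <= 2%:R -> X <= e * Y) -> X <= 0.
Proof.
move=> Xr Y0 q0 small; rewrite real_leNgt ?real0 //; apply/negP => X0.
have D0 : 0 < Y + q * X + 1 by rewrite ltr_wpDl // addr_ge0 // mulr_ge0 // ltW.
(* This [e] is admissible and refutes [X > 0]: the denominator exceeds [q * X], so [e * q <= 2], and
   it exceeds [Y], so [e * Y < X]. *)
have e0 : 0 < X / (Y + q * X + 1) by rewrite divr_gt0.
have eq : X / (Y + q * X + 1) * q <= 2%:R.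
  rewrite mulrAC ler_pdivrMr // mulrC.
  apply: (@le_trans _ _ (Y + q * X + 1)); first by rewrite -addrA addrCA lerDl addr_ge0.
  by rewrite mulr_natl mulr2n lerDl ltW.
have := small _ e0 eq; rewrite mulrAC ler_pdivlMr // ler_pM2l //.
by rewrite -addrA gerDl lt_geF // ltr_wpDl // mulr_ge0 // ltW.
Qed.

Lemma braket_lagrange_op u v :
  braket u (G *m v) = \sum_i p i * (braket (psi i) v * braket u (P i *m psi i)).
Proof.
rewrite mulmx_suml braket_sumr; apply: eq_bigr => i _.
by rewrite -scalemxAl braketZr outer_mul braketZr.
Qed.

(* To first order in [e], moves the weight [2 e |v><v|] to outcome [j]. *)
Definition perturbed_povm j (v : 'cV[C]_(2 * 2)) (e : C) i : 'M[C]_(2 * 2) :=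
  let Q := v *m v^t* in
  (1%:M - e *: Q)^t* *m P i *m (1%:M - e *: Q)
  + (if i == j then (2%:R * e - e ^+ 2 * braket v v) *: Q else 0).

Lemma outer_psd (v : 'cV[C]_(2 * 2)) : psd (v *m v^t*).
Proof. by rewrite -{1}[v]trmxCK; exact: gram_psd. Qed.

(** [(1 - e Q)^2 = 1 - (2 e - e^2 <v|v>) Q], and outcome [j] receives what is removed; the bound on
    [e] makes that weight nonnegative. *)
Lemma perturbed_is_povm j v e : 0 < e -> e * braket v v <= 2%:R ->
  is_povm (perturbed_povm j v e).
Proof.
move=> e0 le2; have er : e^* = e by rewrite geC0_conj // ltW.
split=> [i|].
  rewrite /perturbed_povm => w; rewrite mulmxDl braketDr addr_ge0 //.
    exact: psd_conj.
  case: eqP => _; last by rewrite mul0mx braket0r.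
  rewrite -scalemxAl braketZr mulr_ge0 ?outer_psd //.
  rewrite (_ : _ - _ = e * (2%:R - e * braket v v)); last by ring.
  by rewrite mulr_ge0 ?subr_ge0 // ltW.
rewrite big_split /= -mulmx_suml -mulmx_sumr sumP mulmx1 -big_mkcond big_pred1_eq.
set Q := v *m v^t*.
have QQ : Q *m Q = braket v v *: Q.
  by rewrite /Q mulmxA outer_mul scalemxAl.
have adjQ : Q^t* = Q by exact/psd_adj/outer_psd.
rewrite adjmxD adjmxN adjmxZ adjmx_scalar conjC1 er adjQ.
rewrite mulmxBl !mulmxBr !mul1mx mulmx1 -!scalemxAl -!scalemxAr QQ !scalerA.
rewrite opprB addrA -!scaleNr -!addrA -!scalerDl -[RHS]addr0 -[in RHS](scale0r Q).
by congr (_ + _ *: _); ring.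
Qed.

Lemma lagrange_op_ge_re j v :
  p j * `|braket (psi j) v| ^+ 2 *+ 2
    <= braket v (G *m v) + (braket v (G *m v))^*.
Proof.
set g := braket v _; set c := _ * _ ^+ 2.
have c0 : 0 <= c by rewrite mulr_ge0 // exprn_ge0.
rewrite -subr_le0; apply: (@real_le0_of_small _ (braket v v * c) (braket v v)).
- rewrite rpredB //; first by rewrite rpredMn // ger0_real.
  by rewrite CrealE rmorphD /= conjCK addrC.
- by rewrite mulr_ge0 ?braket_ge0.
- exact: braket_ge0.
move=> e e0 le2; have er : e^* = e by rewrite geC0_conj // ltW.
have := (optP.2 _ (perturbed_is_povm j e0 le2)).
rewrite -subr_le0 /succ_prob.
set K := \sum_i p i * (`|braket (psi i) v| ^+ 2 * braket v (P i *m v)).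
have K0 : 0 <= K.
  by apply: sumr_ge0 => i _; rewrite !mulr_ge0 ?exprn_ge0 // psdP.
(* The gain in success probability, which optimality makes nonpositive. Dropping the nonnegative
   [e * K] and dividing by [e] leaves the inequality required by [real_le0_of_small]. *)
suff -> : \sum_i p i * braket (psi i) (perturbed_povm j v e i *m psi i)
  - \sum_i p i * braket (psi i) (P i *m psi i)
  = e * (c *+ 2 - (g + g^*) - e * (braket v v * c) + e * K).
  rewrite pmulr_rle0 // => le0; rewrite -subr_le0.
  by apply: le_trans le0; rewrite lerDl mulr_ge0 // ltW.
rewrite /perturbed_povm.
under eq_bigr => i _ do rewrite mulmxDl braketDr mulrDr.
rewrite big_split /= addrAC.
have -> : \sum_i p i * braket (psi i) ((if i == j
     then (2%:R * e - e ^+ 2 * braket v v) *: (v *m v^t*) else 0) *m psi i)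
   = (2%:R * e - e ^+ 2 * braket v v) * c.
  rewrite (bigD1 j) //= big1 ?addr0 => [|i /negPf->]; last first.
    by rewrite mul0mx braket0r mulr0.
  rewrite eqxx -scalemxAl outer_mul !braketZr mulrCA /c normCK braketC.
  by congr (_ * (_ * _)); rewrite mulrC.
have -> : g^* = \sum_i p i * (braket v (psi i) * braket (psi i) (P i *m v)).
  rewrite /g braket_lagrange_op rmorph_sum; apply: eq_bigr => i _.
  rewrite !rmorphM /= geC0_conj // braketC braketC.
  by rewrite braket_adjr adjP.
rewrite /g braket_lagrange_op -sumrB.
have term i : p i * braket (psi i) ((1%:M - e *: (v *m v^t*))^t* *m P i
     *m (1%:M - e *: (v *m v^t*)) *m psi i) - p i * braket (psi i) (P i *m psi i)
  = - e * (p i * (braket (psi i) v * braket v (P i *m psi i)))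
    - e * (p i * (braket v (psi i) * braket (psi i) (P i *m v)))
    + e ^+ 2 * (p i * (`|braket (psi i) v| ^+ 2 * braket v (P i *m v))).
  rewrite -!mulmxA -braket_adjr mulmxBl mul1mx -scalemxAl outer_mul scalerA.
  rewrite mulmxBr -scalemxAr !braketBl !braketBr !braketZl !braketZr.
  by rewrite rmorphM /= er normCK !braketC; ring.
under eq_bigr => i _ do rewrite term.
by rewrite !big_split /= sumrN -!mulr_sumr -/K; ring.
Qed.

(* Holevo-Yuen-Kennedy-Lax conditions. *)
Theorem optimality_conditions :
  [/\ G^t* = G, forall j v, p j * `|braket (psi j) v| ^+ 2 <= braket v (G *m v)
    & forall i, G *m P i = p i *: (psi i *m (psi i)^t* *m P i)].
Proof.
(* The first-order bound controls only [G + G^t*], so the conditions are first proved for the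
   Hermitian part of [G]. *)
pose H := 2%:R^-1 *: (G + G^t*).
have two0 : 2%:R != 0 :> C by rewrite pnatr_eq0.
have H_ge j v : p j * `|braket (psi j) v| ^+ 2 <= braket v (H *m v).
  rewrite -scalemxAl braketZr mulmxDl braketDr -braket_adjr -[X in _ + X]braketC.
  by rewrite ler_pdivlMl ?ltr0n // mulr_natl lagrange_op_ge_re.
have psdA i : psd (H - p i *: (psi i *m (psi i)^t*)).
  move=> v; rewrite mulmxBl braketBr subr_ge0 (le_trans _ (H_ge i v)) //.
  by rewrite -scalemxAl outer_mul !braketZr normCK braketC.
have trG : \tr G = \sum_i p i * braket (psi i) (P i *m psi i).
  rewrite raddf_sum; apply: eq_bigr => i _.
  by rewrite /= mxtraceZ mxtrace_mulC trace_mx11.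
have trH : \tr H = \tr G.
  have trG0 : 0 <= \tr G.
    by rewrite trG; apply: sumr_ge0 => i _; rewrite mulr_ge0 // psdP.
  rewrite mxtraceZ mxtraceD trace_map_mx mxtrace_tr /= geC0_conj //.
  by rewrite -mulr2n -[(\tr G) *+ 2]mulr_natl mulKf.
(* These products of positive semidefinite matrices have nonnegative traces, which sum to
   [\tr H - \tr G = 0], so each trace vanishes. *)
have tr0 i : (H - p i *: (psi i *m (psi i)^t*)) *m P i = 0.
  apply: (psd_mul_trace_eq0 (psdA i) (psdP i)); apply/eqP.
  have : \sum_i \tr ((H - p i *: (psi i *m (psi i)^t*)) *m P i) == 0.
    have term k : \tr ((H - p k *: (psi k *m (psi k)^t*)) *m P k)
        = \tr (H *m P k) - p k * braket (psi k) (P k *m psi k).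
      rewrite mulmxBl raddfB /= -[p k *: _ *m _]scalemxAl mxtraceZ -(mulmxA (psi k)).
      by rewrite [in X in _ - _ * X]mxtrace_mulC trace_mx11 -mulmxA.
    under eq_bigr => k _ do rewrite term.
    by rewrite sumrB -raddf_sum /= -mulmx_sumr sumP mulmx1 trH trG subrr.
  rewrite psumr_eq0 => [/allP/(_ i (mem_index_enum i)) //|k _].
  exact: psd_mul_trace_ge0.
have HP i : H *m P i = p i *: (psi i *m (psi i)^t* *m P i).
  by apply/eqP; rewrite -subr_eq0 scalemxAl -mulmxBl tr0.
(* Summing [HP] over [i] gives [G] back up to adjoint; as [H] is Hermitian, [H = G]. *)
have HG : H = G^t*.
  rewrite -[H]mulmx1 -sumP mulmx_sumr adjmx_sum; apply: eq_bigr => i _.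
  by rewrite HP adjmxZ geC0_conj // !adjmxM trmxCK adjP mulmxA.
have adjH : H^t* = H.
  by rewrite adjmxZ adjmxD trmxCK geC0_conj ?invr_ge0 ?ler0n // addrC.
have GH : H = G by rewrite -adjH HG trmxCK.
by split; rewrite -GH.
Qed.
End Optimality.

(** * Orthogonality of the vectors [P i *m psi i] *)

Section OptimalBasis.
Variables (C : numClosedFieldType) (n : nat) (p : 'I_n -> C).
Variables (psi : 'I_n -> 'cV[C]_(2 * 2)) (P : 'I_n -> 'M[C]_(2 * 2)).
Variable Phi : 'cV[C]_(2 * 2).
Local Notation Psi := (\matrix_(l < n, k < 2 * 2) psi l k 0).

Lemma mul_rows_tr (d : 'rV[C]_n) : (d *m Psi)^T = \sum_l d 0 l *: psi l.
Proof.
apply/matrixP => k z; rewrite ord1 !mxE summxE.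
by apply: eq_bigr => l _; rewrite !mxE.
Qed.

Lemma row_free_lin_indep (c : 'I_n -> C) : row_free Psi ->
  \sum_l c l *: psi l = 0 -> forall l, c l = 0.
Proof.
move=> free0 sum0 l; have : \row_l c l *m Psi == 0.
  apply/eqP/trmx_inj; rewrite mul_rows_tr trmx0 -[RHS]sum0.
  by apply: eq_bigr => k _; rewrite mxE.
by rewrite mulmx_free_eq0 // => /eqP/matrixP/(_ 0 l); rewrite !mxE.
Qed.

Hypotheses (p_gt0 : forall i, 0 < p i) (optP : optimal_povm p psi P).
Hypotheses (indep : row_free Psi)
  (span : forall v, (v^T <= Psi)%MS <-> braket Phi v = 0).
Hypothesis detect : forall i, braket (psi i) (P i *m psi i) != 0.

Local Notation u i := (P i *m psi i).
Local Notation G := (lagrange_op p psi P).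

Let adjP i : (P i)^t* = P i.
Proof. by apply: psd_adj; case: optP => [[]]. Qed.
Let sumP : \sum_i P i = 1%:M. Proof. by case: optP => [[]]. Qed.
Let p_neq0 i : p i != 0. Proof. by rewrite gt_eqF. Qed.

Let optC := optimality_conditions (fun i => ltW (p_gt0 i)) optP.

Lemma lagrange_povm i x : G *m (P i *m x) = (p i * braket (u i) x) *: psi i.
Proof.
have [_ _ GP] := optC.
rewrite mulmxA GP -scalemxAl -mulmxA outer_mul scalerA.
by rewrite braket_adjl adjP.
Qed.

Lemma lagrange_sum x : G *m x = \sum_i (p i * braket (u i) x) *: psi i.
Proof.
have {1}-> : x = \sum_i P i *m x by rewrite -mulmx_suml sumP mul1mx.
by rewrite mulmx_sumr; apply: eq_bigr => i _; exact: lagrange_povm.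
Qed.

Lemma braket_Phi_psi i : braket Phi (psi i) = 0.
Proof.
apply/span; have -> : (psi i)^T = row i Psi by apply/rowP => k; rewrite !mxE.
exact: row_sub.
Qed.

(** [G] kills [Phi] because [Phi] is orthogonal to every [psi i]; the expansion of [G *m Phi] over
    the independent [psi l] then has zero coefficients. *)
Lemma optimal_basis_perp i : braket Phi (u i) = 0.
Proof.
rewrite -braketC; apply/eqP; rewrite conjC_eq0.
have : G *m Phi = 0.
  rewrite mulmx_suml big1 // => k _.
  by rewrite -scalemxAl outer_mul -braketC braket_Phi_psi conjC0 scale0r scaler0.
rewrite lagrange_sum => /(row_free_lin_indep indep)/(_ i)/eqP.
by rewrite mulf_eq0 (negPf (p_neq0 i)).
Qed.

Lemma lagrange_basis i :
  G *m u i = (p i * braket (psi i) (u i)) *: psi i.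
Proof. by rewrite lagrange_povm braket_adjr adjP. Qed.

(** The two expressions of [G *m u j], from [lagrange_sum] and [lagrange_basis], have equal
    coefficients over the independent [psi l]. *)
Lemma optimal_basis_orth i j :
  braket (u i) (u j) = if i == j then braket (psi i) (u i) else 0.
Proof.
have /eqP : \sum_l (p l * (braket (u l) (u j)
    - if l == j then braket (psi l) (u l) else 0)) *: psi l = 0.
  under eq_bigr => l _ do rewrite mulrBr scalerBl.
  rewrite sumrB -lagrange_sum (bigD1 j) //= eqxx lagrange_basis big1 ?addr0 ?subrr //.
  by move=> l /negPf->; rewrite mulr0 scale0r.
move/eqP/(row_free_lin_indep indep)/(_ i)/eqP.
by rewrite mulf_eq0 (negPf (p_neq0 i)) subr_eq0 => /eqP.
Qed.

(** [u j] is orthogonal to [Phi], hence of the form [G *m w], and [G *m P i] maps [u j] to a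
    multiple of [psi i] with factor [p i * braket (u i) (u j) = 0]. *)
Lemma optimal_basis_povm i j : i != j -> braket (u j) (P i *m u j) = 0.
Proof.
move=> ij; have [d defd] : exists d : 'rV[C]_n, (u j)^T = d *m Psi.
  by apply/submxP/span; exact: optimal_basis_perp.
(* By [lagrange_basis], [G] sends [u l] to a multiple of [psi l], nonzero by [detect]; [w] divides
   by that factor. *)
pose w := \sum_l (d 0 l / (p l * braket (psi l) (u l))) *: u l.
have {1}-> : u j = G *m w.
  rewrite -[LHS]trmxK defd mul_rows_tr mulmx_sumr; apply: eq_bigr => l _.
  by rewrite -scalemxAr lagrange_basis scalerA divfK // mulf_neq0.
have [adjG _ _] := optC.
by rewrite braket_adjr adjG lagrange_povm optimal_basis_orth (negPf ij)
  mulr0 scale0r braket0r.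
Qed.

End OptimalBasis.

(** * Lower bound on the detection probabilities *)

Lemma big_ord3 (V : nmodType) (F : 'I_3 -> V) i j k :
  i != j -> i != k -> j != k -> \sum_l F l = F i + F j + F k.
Proof.
move=> ij ik jk; rewrite (bigD1 i) //= (bigD1 j) 1?eq_sym //=.
rewrite (bigD1 k) /= ?[k == _]eq_sym ?ik ?jk // big_pred0 ?addr0 ?addrA // => l.
by move: i j k l ij ik jk => [[|[|[|?]]] ?] [[|[|[|?]]] ?] [[|[|[|?]]] ?] [[|[|[|?]]] ?].
Qed.

(** Testing [G >= p_i |psi_i><psi_i|] on [psi i] bounds [p i * d], with [d] the failure probability
    on [psi i], by two cross terms whose amplitudes have squares summing to at most [d].
    Cauchy-Schwarz then gives [(p i * d)^2 <= (a + b) * d], where [a + b] is the left side of the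
    hypothesis. *)
Lemma optimal_detection_gt (C : numClosedFieldType) (p : 'I_3 -> C)
  (psi : 'I_3 -> 'cV[C]_(2 * 2)) P (lam2 : C) (i j k : 'I_3) :
  i != j -> i != k -> j != k ->
  (forall l, braket (psi l) (psi l) = 1) -> (forall l, 0 < p l) ->
  optimal_povm p psi P ->
  p j ^+ 2 * `|braket (psi i) (psi j)| ^+ 2
    + p k ^+ 2 * `|braket (psi i) (psi k)| ^+ 2 < p i ^+ 2 * lam2 ->
  1 - braket (psi i) (P i *m psi i) < lam2.
Proof.
move=> ij ik jk unit p0 optP; have [[psdP sumP] _] := optP.
have [_ Gge _] := optimality_conditions (fun i => ltW (p0 i)) optP.
set a := p j ^+ 2 * _; set b := p k ^+ 2 * _ => small.
pose q l m := braket (psi l) (P m *m psi l).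
have q0 l m : 0 <= q l m by exact: psdP.
have q1 l : q l i + q l j + q l k = 1.
  by rewrite -(big_ord3 (q l) ij ik jk) -braket_sumr -mulmx_suml sumP mul1mx.
have q_le1 l m : q l m <= 1.
  rewrite -(q1 l) -(big_ord3 (q l) ij ik jk) (bigD1 m) //= lerDl.
  by rewrite sumr_ge0.
have off m : `|braket (psi i) (P m *m psi m)| ^+ 2 <= q i m.
  apply: le_trans (psd_CauchySchwarz _ _ (psdP m)) _.
  by rewrite -[leRHS]mulr1 ler_wpM2l ?q0 ?q_le1.
rewrite -/(q i i); set d := 1 - _.
have dE : d = q i j + q i k by rewrite /d -(q1 i); ring.
have d0 : 0 <= d by rewrite dE addr_ge0.
set A := `|braket (psi i) (psi j)| in a small; set B := `|braket (psi i) (psi k)| in b small.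
have := off j; set x := `|_| => xq; have := off k; set y := `|_| => yq.
have [x0 y0] : 0 <= x /\ 0 <= y by rewrite !normr_ge0.
have pd : p i * d <= p j * A * x + p k * B * y.
  have := Gge i (psi i); rewrite braket_lagrange_op (big_ord3 _ ij ik jk) !unit normr1 expr1n.
  rewrite -/(q i i) mul1r -addrA -lerBlDl -mulrBr -/d => le_d.
  have pd0 : 0 <= p i * d by rewrite mulr_ge0 // ltW.
  have z0 := le_trans pd0 le_d; apply: le_trans le_d _.
  rewrite -(ger0_norm z0) (le_trans (ler_normD _ _)) //.
  by rewrite !normrM !(gtr0_norm (p0 _)) !mulrA [in X in X <= _]norm_braketC
    [X in _ + _ * X * _ <= _]norm_braketC.
have [A0 B0] : 0 <= A /\ 0 <= B by rewrite !normr_ge0.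
have pjA : 0 <= p j * A by rewrite mulr_ge0 // ltW.
have pkB : 0 <= p k * B by rewrite mulr_ge0 // ltW.
have ab0 : 0 <= a + b by rewrite /a /b -!exprMn addr_ge0 // exprn_ge0.
have lam0 : 0 < lam2.
  by rewrite -(pmulr_rgt0 _ (exprn_gt0 2 (p0 i))) (le_lt_trans ab0).
have [->//|dn0] := eqVneq d 0.
have {}d0 : 0 < d by rewrite lt_def dn0.
have pi2 : 0 < p i ^+ 2 * d by rewrite mulr_gt0 ?exprn_gt0.
rewrite -(ltr_pM2l pi2) (_ : _ * d = p i ^+ 2 * d ^+ 2); last by ring.
have : (p i * d) ^+ 2 <= (p j * A * x + p k * B * y) ^+ 2.
  by rewrite lerXn2r ?nnegrE ?addr_ge0 ?mulr_ge0 // ltW.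
rewrite exprMn => /le_lt_trans; apply.
apply: (@le_lt_trans _ _ ((a + b) * (x ^+ 2 + y ^+ 2))).
  (* Lagrange's identity: the defect in Cauchy-Schwarz is a square. *)
  rewrite -subr_ge0 (_ : _ - _ = (p j * A * y - p k * B * x) ^+ 2); last first.
    by rewrite /a /b; ring.
  by rewrite real_exprn_even_ge0 // rpredB // ger0_real // mulr_ge0.
apply: (@le_lt_trans _ _ ((a + b) * d)); first by rewrite ler_wpM2l // dE lerD.
by rewrite mulrAC ltr_pM2r.
Qed.

(** * Perfect discrimination by LOCC *)

Section Kronecker.
Variable C : numClosedFieldType.

Lemma pair_idx_proof m p (a : 'I_m) (b : 'I_p) : (a * p + b < m * p)%N.
Proof.
by rewrite (leq_trans (_ : _ < a.+1 * p)%N) ?leq_pmul2r ?(leq_ltn_trans _ (ltn_ord b)) //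
  ?mulSnr ?ltn_add2l ?leq_mul2r ?ltn_ord ?orbT.
Qed.

Definition pair_idx m p (a : 'I_m) (b : 'I_p) : 'I_(m * p) :=
  Ordinal (pair_idx_proof a b).

Lemma pair_idx1 m p (a : 'I_m) (b : 'I_p) : kron_idx1 (pair_idx a b) = a.
Proof.
apply: val_inj => /=; have p0 : (0 < p)%N by apply: leq_ltn_trans (ltn_ord b).
by rewrite divnMDl // divn_small ?addn0.
Qed.

Lemma pair_idx2 m p (a : 'I_m) (b : 'I_p) : kron_idx2 (pair_idx a b) = b.
Proof. by apply: val_inj; rewrite /= modnMDl modn_small. Qed.

Lemma pair_idxK m p (k : 'I_(m * p)) : pair_idx (kron_idx1 k) (kron_idx2 k) = k.
Proof. by apply: val_inj; rewrite /= -divn_eq. Qed.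

Lemma big_pair_idx (V : nmodType) m p (F : 'I_(m * p) -> V) :
  \sum_k F k = \sum_a \sum_b F (pair_idx a b).
Proof.
rewrite pair_big /= (reindex (fun ab : 'I_m * 'I_p => pair_idx ab.1 ab.2)) //.
exists (fun k => (kron_idx1 k, kron_idx2 k)) => [[a b]|k] _ /=.
  by rewrite pair_idx1 pair_idx2.
exact: pair_idxK.
Qed.

Lemma kronmx_mul m n l p q r (A : 'M[C]_(m, n)) (B : 'M[C]_(n, l))
    (A' : 'M[C]_(p, q)) (B' : 'M[C]_(q, r)) :
  kronmx A A' *m kronmx B B' = kronmx (A *m B) (A' *m B').
Proof.
apply/matrixP => i j; rewrite !mxE big_pair_idx big_distrlr /=.
apply: eq_bigr => a _; apply: eq_bigr => b _.
by rewrite !mxE pair_idx1 pair_idx2 mulrACA.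
Qed.

Lemma kronmx_adj m n p q (A : 'M[C]_(m, n)) (B : 'M[C]_(p, q)) :
  (kronmx A B)^t* = kronmx (A^t*) (B^t*).
Proof. by apply/matrixP => i j; rewrite !mxE rmorphM. Qed.

Lemma kronmx_suml m n p q I (r : seq I) (Q : pred I) (F : I -> 'M[C]_(m, n))
    (B : 'M[C]_(p, q)) :
  \sum_(i <- r | Q i) kronmx (F i) B = kronmx (\sum_(i <- r | Q i) F i) B.
Proof.
apply/matrixP => i j; rewrite !mxE !summxE mulr_suml.
by apply: eq_bigr => k _; rewrite mxE.
Qed.

Lemma kronmx_sumr m n p q I (r : seq I) (Q : pred I) (F : I -> 'M[C]_(p, q))
    (A : 'M[C]_(m, n)) :
  \sum_(i <- r | Q i) kronmx A (F i) = kronmx A (\sum_(i <- r | Q i) F i).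
Proof.
apply/matrixP => i j; rewrite !mxE !summxE mulr_sumr.
by apply: eq_bigr => k _; rewrite mxE.
Qed.

Lemma kronmxZl m n p q a (A : 'M[C]_(m, n)) (B : 'M[C]_(p, q)) :
  kronmx (a *: A) B = a *: kronmx A B.
Proof. by apply/matrixP => i j; rewrite !mxE mulrA. Qed.

Lemma kronmxZr m n p q a (A : 'M[C]_(m, n)) (B : 'M[C]_(p, q)) :
  kronmx A (a *: B) = a *: kronmx A B.
Proof. by apply/matrixP => i j; rewrite !mxE mulrCA. Qed.

Lemma kronmx1 m n : kronmx (1%:M : 'M[C]_m) (1%:M : 'M[C]_n) = 1%:M.
Proof.
apply/matrixP => i j; rewrite !mxE -natrM mulnb -[in RHS](pair_idxK i) -[in RHS](pair_idxK j).
congr (_%:R); congr nat_of_bool; apply/andP/eqP => [[/eqP-> /eqP->] //|/(congr1 val) /= ij].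
rewrite -(pair_idxK i) -(pair_idxK j) !pair_idx1 !pair_idx2.
suff -> : i = j by rewrite !eqxx.
by apply: val_inj; rewrite /= (divn_eq i n) (divn_eq j n).
Qed.

End Kronecker.

(** * Effects along an LOCC protocol *)

Section Locc.
Variables (C : numClosedFieldType) (D n : nat).
Implicit Types (t : locc C D n) (A B : 'M[C]_D).

Definition local_effect A : 'M[C]_2 :=
  (qubit_emb C D)^t* *m (A^t* *m A) *m qubit_emb C D.

Lemma local_effect_gram A :
  local_effect A = (A *m qubit_emb C D)^t* *m (A *m qubit_emb C D).
Proof. by rewrite adjmxM /local_effect !mulmxA. Qed.

Lemma local_effect_adj A : (local_effect A)^t* = local_effect A.
Proof. by rewrite local_effect_gram [LHS]adjmxM trmxCK. Qed.

Lemma local_effect_sum A m (K : 'I_m -> 'M[C]_D) :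
  \sum_r (K r)^t* *m K r = 1%:M ->
  \sum_r local_effect (K r *m A) = local_effect A.
Proof.
move=> K1; rewrite /local_effect -mulmx_suml -mulmx_sumr; congr (_ *m _ *m _).
under eq_bigr => r _ do rewrite adjmxM mulmxA -[_ *m _ *m K r]mulmxA.
by rewrite -mulmx_suml -mulmx_sumr K1 mulmx1.
Qed.

Lemma local_effect1 : (2 <= D)%N -> local_effect 1%:M = 1%:M.
Proof.
move=> D2; rewrite /local_effect adjmx_scalar conjC1 mulmx1 mulmx1.
apply/matrixP => i j; rewrite !mxE (bigD1 (widen_ord D2 i)) //= big1 => [|k ki].
  by rewrite !mxE /= eqxx conjC1 mul1r addr0.
by rewrite !mxE (_ : (k : nat) == i = false) ?conjC0 ?mul0r //; apply: negbTE.
Qed.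

Lemma locc_effect_psd t A B i : psd (locc_effect t A B i).
Proof.
elim: t A B => [k|m K next IH|m K next IH] A B /=; try by apply: psd_sum => r _.
case: eqP => _; last by move=> v; rewrite mul0mx braket0r.
rewrite -!/(local_effect _) !local_effect_gram -kronmx_mul -kronmx_adj.
exact: gram_psd.
Qed.

(** By completeness of each local instrument, summing over the branches of a node restores the local
    effect held before it. *)
Lemma locc_effect_sum t A B : locc_wf t ->
  \sum_i locc_effect t A B i = kronmx (local_effect A) (local_effect B).
Proof.
elim: t A B => [k|m K next IH|m K next IH] A B /=.
- by move=> _; rewrite -big_mkcond /= (big_pred1 k) // => i; rewrite eq_sym.
- case=> K1 wf; rewrite exchange_big -(local_effect_sum A K1) -kronmx_suml.
  by apply: eq_bigr => r _; exact: IH.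
- case=> K1 wf; rewrite exchange_big -(local_effect_sum B K1) -kronmx_sumr.
  by apply: eq_bigr => r _; exact: IH.
Qed.

Variable u : 'I_n -> 'cV[C]_(2 * 2).

(** Zero-error discrimination; the [u j] need not be normalized. *)
Definition discriminates (P : 'I_n -> 'M[C]_(2 * 2)) :=
  forall i j, i != j -> braket (u j) (P i *m u j) = 0.

Definition preserves_orth (E : 'M[C]_(2 * 2)) :=
  forall i j, i != j -> braket (u i) (E *m u j) = 0.

(** Positivity makes the effect of outcome [k] kill every [u l] with [l != k], so no outcome
    contributes to a cross term. *)
Lemma locc_preserves_orth t A B : locc_wf t -> discriminates (locc_effect t A B) ->
  preserves_orth (kronmx (local_effect A) (local_effect B)).
Proof.
move=> wf disc i j ij; rewrite -(locc_effect_sum A B wf) mulmx_suml braket_sumr.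
have kill k l : k != l -> locc_effect t A B k *m u l = 0.
  by move=> kl; apply: psd_ker (disc _ _ kl); exact: locc_effect_psd.
rewrite big1 // => k _; have [->|/kill->] := eqVneq k j; last by rewrite braket0r.
rewrite braket_adjl (psd_adj (locc_effect_psd _ _ _ _)) kill ?braket0l //.
by rewrite eq_sym.
Qed.

Lemma discriminates_sum m (Q : 'I_m -> 'I_n -> 'M[C]_(2 * 2)) :
  (forall r i, psd (Q r i)) -> discriminates (fun i => \sum_r Q r i) ->
  forall r, discriminates (Q r).
Proof.
move=> psdQ disc r i j /disc/eqP; rewrite mulmx_suml braket_sumr psumr_eq0.
  by move=> /allP/(_ r (mem_index_enum r))/eqP.
by move=> s _; exact: psdQ.
Qed.

Lemma sum_neq0 (V : nmodType) m (F : 'I_m -> V) :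
  \sum_r F r != 0 -> exists r, F r != 0.
Proof.
move=> F0; apply/existsP; apply: contraNT F0; rewrite negb_exists => /forallP F0.
by rewrite big1 // => r _; apply/eqP; rewrite -[_ == _]negbK F0.
Qed.

(* Follow a branch on which both local operators remain multiples of the
   identity; it cannot reach a leaf, so some measurement on it is nontrivial. *)
Lemma locc_local_split t A B : locc_wf t ->
  (forall k : 'I_n, exists j, j != k) -> (forall j, u j != 0) ->
  discriminates (locc_effect t A B) ->
  is_scalar_mx (local_effect A) -> local_effect A != 0 ->
  is_scalar_mx (local_effect B) -> local_effect B != 0 ->
  exists E : 'M[C]_2, [/\ ~~ is_scalar_mx E, E^t* = E
    & preserves_orth (kronmx E 1%:M) \/ preserves_orth (kronmx 1%:M E)].
Proof.
move=> + other u0.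
elim: t A B => [k|m K next IH|m K next IH] A B /=.
- move=> _ disc /is_scalar_mxP[a Ea] A0 /is_scalar_mxP[b Eb] B0.
  (* The effect of the leaf is a nonzero multiple of the identity, so its label [k] would also be
     announced on [u j]. *)
  have [j jk] := other k; have := disc k j; rewrite eq_sym jk eqxx => /(_ isT)/eqP.
  rewrite -!/(local_effect _) Ea Eb -[a%:M]scalemx1 -[b%:M]scalemx1 kronmxZl kronmxZr kronmx1.
  rewrite scalerA scalemx1 mul_scalar_mx braketZr !mulf_eq0 braket_eq0 (negPf (u0 j)) orbF.
  case/orP => /eqP z; [move: A0|move: B0]; rewrite ?Ea ?Eb z.
    by rewrite raddf0 eqxx.
  by rewrite raddf0 eqxx.
- case=> K1 wf disc sA A0 sB B0.
  have {}disc r : discriminates (locc_effect (next r) (K r *m A) B).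
    by apply: (discriminates_sum _ disc) => ? ?; exact: locc_effect_psd.
  have [/existsP[r ns]|] := boolP [exists r, ~~ is_scalar_mx (local_effect (K r *m A))].
    exists (local_effect (K r *m A)); split=> //; first exact: local_effect_adj.
    left=> i j ij; have /is_scalar_mxP[b Eb] := sB.
    have := locc_preserves_orth (wf r) (disc r) ij; rewrite Eb -[b%:M]scalemx1 kronmxZr.
    rewrite -scalemxAl braketZr => /eqP; rewrite mulf_eq0 => /orP[/eqP b0|/eqP //].
    by move: B0; rewrite Eb b0 raddf0 eqxx.
  (* Every outcome leaves a scalar effect; these sum to the nonzero effect of [A], so the descent
     continues along a nonzero one. *)
  rewrite negb_exists => /forallP sK; rewrite -(local_effect_sum A K1) in A0.
  have [r Kr0] := sum_neq0 A0.
  apply: (IH r _ _ (wf r) (disc r)) => //; exact: negbNE (sK r).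
- case=> K1 wf disc sA A0 sB B0.
  have {}disc r : discriminates (locc_effect (next r) A (K r *m B)).
    by apply: (discriminates_sum _ disc) => ? ?; exact: locc_effect_psd.
  have [/existsP[r ns]|] := boolP [exists r, ~~ is_scalar_mx (local_effect (K r *m B))].
    exists (local_effect (K r *m B)); split=> //; first exact: local_effect_adj.
    right=> i j ij; have /is_scalar_mxP[b Eb] := sA.
    have := locc_preserves_orth (wf r) (disc r) ij; rewrite Eb -[b%:M]scalemx1 kronmxZl.
    rewrite -scalemxAl braketZr => /eqP; rewrite mulf_eq0 => /orP[/eqP b0|/eqP //].
    by move: A0; rewrite Eb b0 raddf0 eqxx.
  rewrite negb_exists => /forallP sK; rewrite -(local_effect_sum B K1) in B0.
  have [r Kr0] := sum_neq0 B0.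
  apply: (IH r _ _ (wf r) (disc r)) => //; exact: negbNE (sK r).
Qed.

End Locc.

(** * Orthogonal bases of two qubits as 2 x 2 matrices *)

Section TwoByTwo.
Variable C : numClosedFieldType.
Implicit Types (X Y M W E : 'M[C]_2) (v : 'cV[C]_(2 * 2)).

Definition hs X Y : C := \tr (X^t* *m Y).

Definition rowip (k : 'I_2) X Y : C := (X k 0)^* * Y k 0 + (X k 1)^* * Y k 1.

Lemma sum_ord2 (V : nmodType) (F : 'I_2 -> V) : \sum_k F k = F 0 + F 1.
Proof.
rewrite big_ord_recl big_ord_recl big_ord0 addr0.
by congr (F _ + F _); apply: val_inj.
Qed.

Lemma hsE X Y : hs X Y = rowip 0 X Y + rowip 1 X Y.
Proof. by rewrite /hs /rowip /mxtrace sum_ord2 !mxE !sum_ord2 !mxE; ring. Qed.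

Lemma det2E M : \det M = M 0 0 * M 1 1 - M 0 1 * M 1 0.
Proof.
rewrite (expand_det_row _ 0) sum_ord2 /cofactor !det_mx11 !mxE.
have -> : lift 0 0 = 1 :> 'I_2 by apply: val_inj.
have -> : lift 1 0 = 0 :> 'I_2 by apply: val_inj.
by rewrite /= expr0 expr1; ring.
Qed.

Lemma hs_unitary E X Y : E^t* *m E = 1%:M -> hs (E *m X) (E *m Y) = hs X Y.
Proof. by move=> uE; rewrite /hs adjmxM mulmxA -(mulmxA _ (E^t*)) uE mulmx1. Qed.

Lemma norm_det_unitary E : E *m E^t* = 1%:M -> `|\det E| = 1.
Proof.
move=> /(congr1 (fun A => \det A)); rewrite det_mulmx det_map_mx det_tr det1 /=.
by rewrite -normCK => /eqP; rewrite sqrp_eq1 ?normr_ge0 // => /eqP.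
Qed.

Lemma orth2_parallel (x0 x1 v0 v1 : C) :
  (x0 != 0) || (x1 != 0) -> x0^* * v0 + x1^* * v1 = 0 ->
  exists c, v0 = - c * x1^* /\ v1 = c * x0^*.
Proof.
move=> x_neq0 /eqP; rewrite addr_eq0 => /eqP orth.
have [x00|x00] := eqVneq x0 0.
  move: x_neq0 orth; rewrite x00 eqxx /= conjC0 mul0r => x1n /esym/eqP.
  rewrite oppr_eq0 mulf_eq0 conjC_eq0 (negPf x1n) => /eqP ->.
  by exists (- (v0 / x1^*)); rewrite mulr0 opprK divfK ?conjC_eq0.
exists (v1 / x0^*); rewrite divfK ?conjC_eq0 //; split=> //.
apply: (mulfI (_ : x0^* != 0)); first by rewrite conjC_eq0.
by rewrite orth mulNr mulrN mulrA mulrCA divff ?conjC_eq0 // mulr1 mulrC.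
Qed.

(** C^2 has no three nonzero pairwise orthogonal vectors: the last two would be multiples of the
    same vector. *)
Lemma orth2_triple_zero k (N : 'I_3 -> 'M[C]_2) :
  (forall i j, i != j -> rowip k (N i) (N j) = 0) ->
  exists j, N j k 0 = 0 /\ N j k 1 = 0.
Proof.
move=> orth.
have nz (j : 'I_3) : (N j k 0 = 0 /\ N j k 1 = 0) \/ (N j k 0 != 0) || (N j k 1 != 0).
  case: (eqVneq (N j k 0) 0) => [->|] /=; last by right.
  by case: (eqVneq (N j k 1) 0) => [->|] /=; [left|right].
case: (nz 0) => [|n0]; first by exists 0.
case: (nz 1) => [|n1]; first by exists 1.
have [c [c0 c1]] := orth2_parallel n0 (orth 0 1 isT).
(* [lift 0 1] is the index 2. *)
have [e [e0 e1]] := orth2_parallel n0 (orth 0 (lift 0 1) isT).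
exists (lift 0 1); rewrite e0 e1.
have x0 : `|N 0 k 0| ^+ 2 + `|N 0 k 1| ^+ 2 != 0.
  by rewrite paddr_eq0 ?exprn_ge0 // !expf_eq0 !normr_eq0 negb_and.
have c_neq0 : c != 0 by apply: contraTneq n1 => z; rewrite c0 c1 z oppr0 !mul0r eqxx.
have := orth 1 (lift 0 1) isT; rewrite /rowip c0 c1 e0 e1.
rewrite !rmorphM rmorphN /= !conjCK => /eqP.
rewrite (_ : _ + _ = c^* * e * (`|N 0 k 0| ^+ 2 + `|N 0 k 1| ^+ 2)); last first.
  by rewrite !normCK; ring.
rewrite !mulf_eq0 conjC_eq0 (negPf c_neq0) (negPf x0) orbF => /eqP ->.
by rewrite oppr0 !mul0r.
Qed.

(* The rows of [M] and [W] lie in the orthogonal lines spanned by the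
   conjugate-swapped [x] and [y], so both determinants are multiples of the same one. *)
Lemma det_orth_pair (x y : 'I_2 -> C) M W :
  (x 0 != 0) || (x 1 != 0) -> (y 0 != 0) || (y 1 != 0) ->
  (x 0)^* * M 0 0 + (x 1)^* * M 0 1 = 0 -> (y 0)^* * M 1 0 + (y 1)^* * M 1 1 = 0 ->
  (x 0)^* * W 0 0 + (x 1)^* * W 0 1 = 0 -> (y 0)^* * W 1 0 + (y 1)^* * W 1 1 = 0 ->
  hs W M = 0 -> hs W W = 1 ->
  `|\det M| ^+ 2 = `|\det W| ^+ 2 * hs M M ^+ 2.
Proof.
move=> xn yn xM yM xW yW.
have [a [a0 a1]] := orth2_parallel xn xM; have [b [b0 b1]] := orth2_parallel yn yM.
have [c [c0 c1]] := orth2_parallel xn xW; have [d [d0 d1]] := orth2_parallel yn yW.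
pose X := `|x 0| ^+ 2 + `|x 1| ^+ 2; pose Y := `|y 0| ^+ 2 + `|y 1| ^+ 2.
have Xn : X != 0.
  by rewrite paddr_eq0 ?exprn_ge0 // !expf_eq0 !normr_eq0 negb_and.
have Yn : Y != 0.
  by rewrite paddr_eq0 ?exprn_ge0 // !expf_eq0 !normr_eq0 negb_and.
rewrite !det2E !hsE /rowip a0 a1 b0 b1 c0 c1 d0 d1.
rewrite !rmorphM !rmorphN /= !conjCK => orth unitW.
have {}orth : c^* * a * X = - (d^* * b * Y).
  by apply/eqP; rewrite -subr_eq0 opprK -orth /X /Y !normCK; apply/eqP; ring.
have {}unitW : c^* * c * X + d^* * d * Y = 1.
  by rewrite -unitW /X /Y !normCK; ring.
have Xr : X^* = X by rewrite geC0_conj // addr_ge0 ?exprn_ge0.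
have Yr : Y^* = Y by rewrite geC0_conj // addr_ge0 ?exprn_ge0.
have orthC : c * a^* * X = - (d * b^* * Y).
  by have := congr1 (fun z : C => z^*) orth; rewrite rmorphN !rmorphM /= !conjCK Xr Yr.
set D := (x 1 * y 0 - x 0 * y 1)^*.
have Dn e f : `|- e * (x 1)^* * (f * (y 0)^*) - e * (x 0)^* * (- f * (y 1)^*)| ^+ 2
    = e * e^* * (f * f^*) * `|D| ^+ 2.
  rewrite -!normCK -!exprMn -!normrM -normrN /D rmorphB !rmorphM /=.
  by congr (`|_| ^+ 2); ring.
rewrite !Dn [RHS]mulrAC; congr (_ * _).
have XYn : X * Y != 0 by rewrite mulf_neq0.
apply: (mulIf XYn).
(* Squared row norms, [A] and [B] for [M], [A'] and [B'] for [W]. Orthogonality gives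
   [A * A' = B * B']; with [A' + B' = 1] the proportions are swapped, [A = B' * (A + B)] and
   [B = A' * (A + B)], and the product of these is the claim. *)
pose A := a * a^* * X; pose B := b * b^* * Y; pose A' := c * c^* * X; pose B' := d * d^* * Y.
have AB : A * A' = B * B'.
  transitivity ((c^* * a * X) * (c * a^* * X)); first by rewrite /A /A'; ring.
  by rewrite orth orthC /B /B'; ring.
have B'E : B' = 1 - A' by rewrite -unitW /A' /B'; ring.
have BE : B = A' * (A + B).
  rewrite (_ : A' * (A + B) = A * A' + A' * B); last by ring.
  by rewrite AB B'E; ring.
have AE : A = B' * (A + B) by rewrite B'E mulrBl mul1r -BE; ring.
transitivity (A * B); first by rewrite /A /B; ring.
rewrite [X in X * _]AE [X in _ * X]BE.
set m := (X in _ * X ^+ 2 * _).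
have -> : m = A + B by rewrite /m /A /B /X /Y !normCK; ring.
by rewrite /A' /B'; ring.
Qed.

End TwoByTwo.

Section OrthogonalBases.
Variable C : numClosedFieldType.

Lemma ord2_cases (i : 'I_2) : i = 0 \/ i = 1.
Proof. by case: i => [[|[|?]] ?] //; [left|right]; apply: val_inj. Qed.

Lemma matrix2_eq0 (N : 'M[C]_2) k l : k != l ->
  N k 0 = 0 -> N k 1 = 0 -> N l 0 = 0 -> N l 1 = 0 -> N = 0.
Proof.
move=> kl k0 k1 l0 l1; apply/matrixP => i j; rewrite mxE.
have /orP[/eqP->|/eqP->] : (i == k) || (i == l).
- by move: i k l kl {k0 k1 l0 l1} => [[|[|?]] ?] [[|[|?]] ?] [[|[|?]] ?].
- by have [->|->] := ord2_cases j.
- by have [->|->] := ord2_cases j.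
Qed.

(** Equal eigenvalues would make [E] scalar. *)
Lemma spectral_nonscalar2 (E : 'M[C]_2) : E^t* = E -> ~~ is_scalar_mx E ->
  exists U (d : 'rV[C]_2),
    [/\ U^t* *m U = 1%:M, U *m U^t* = 1%:M, E = U^t* *m diag_mx d *m U & d 0 0 != d 0 1].
Proof.
move=> herm ns; have /orthomx_spectralP : E \is normalmx by apply/normalmxP; rewrite herm.
set U := spectralmx E; set d := spectral_diag E => defE.
have uU : U \is unitarymx by exact: spectral_unitarymx.
have UU : U *m U^t* = 1%:M by exact/unitarymxP.
have UU' : U^t* *m U = 1%:M by exact: mulmx1C.
rewrite (invmx_unitary uU) in defE.
exists U, d; split=> //; apply: contra ns => /eqP d01.
have dE : diag_mx d = (d 0 0)%:M.
  apply/matrixP => i j; rewrite !mxE; congr (_ *+ _).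
  by have [->|->] := ord2_cases i; rewrite ?d01.
apply/is_scalar_mxP; exists (d 0 0).
by rewrite defE dE mul_mx_scalar -scalemxAl UU' scalemx1.
Qed.

Lemma rowip_diag k (d : 'rV[C]_2) X Y :
  rowip k X (diag_mx d *m Y) = d 0 k * rowip k X Y.
Proof. by rewrite /rowip mul_diag_mx !mxE; ring. Qed.

Lemma ord3_third (i j : 'I_3) : exists k, (k != i) && (k != j).
Proof.
move: i j => [[|[|[|?]]] ?] [[|[|[|?]]] ?] //;
  first [by exists 0 | by exists 1 | by exists (lift 0 1)].
Qed.

(* In an eigenbasis of [E] both rows of the [M i] form pairwise orthogonal
   families in C^2, so two of the [M i] have a vanishing row. *)
Lemma orthogonal_split_det (M : 'I_3 -> 'M[C]_2) (W E : 'M[C]_2) :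
  E^t* = E -> ~~ is_scalar_mx E -> (forall i, M i != 0) ->
  (forall i j, i != j -> hs (M i) (M j) = 0) ->
  (forall i j, i != j -> hs (M i) (E *m M j) = 0) ->
  (forall i, hs W (M i) = 0) -> hs W W = 1 ->
  exists k, `|\det (M k)| ^+ 2 = `|\det W| ^+ 2 * hs (M k) (M k) ^+ 2.
Proof.
move=> herm ns M0 orthM orthE orthW unitW.
have [U [d [UU UU' defE d01]]] := spectral_nonscalar2 herm ns.
have Uinj (X : 'M[C]_2) : X != 0 -> U *m X != 0.
  apply: contraNneq => UX0; by rewrite -[X]mul1mx -UU -mulmxA UX0 mulmx0.
pose N j := U *m M j.
(* The two row products sum to 0, and so do they when weighted by the distinct eigenvalues [d 0 0]
   and [d 0 1]; hence both vanish. *)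
have rows k i j : i != j -> rowip k (N i) (N j) = 0.
  move=> ij; have := orthM i j ij; rewrite -(hs_unitary _ _ UU) hsE => e1.
  have : hs (N i) (diag_mx d *m N j) = 0.
    by rewrite -(orthE i j ij) defE /hs /N adjmxM !mulmxA.
  rewrite hsE !rowip_diag => e2.
  have r0 : rowip 0 (N i) (N j) = 0.
    apply: (mulfI (_ : d 0 0 - d 0 1 != 0)); first by rewrite subr_eq0.
    rewrite mulr0 -[RHS](subrr (d 0 1 * 0)) [in X in _ = X - _]mulr0.
    rewrite -[X in _ = X - _]e2 -e1 -/(N i) -/(N j).
    by move: (rowip 0 _ _) (rowip 1 _ _) => r0 r1; ring.
  have r1 : rowip 1 (N i) (N j) = 0 by rewrite -e1 -/(N i) -/(N j) r0 add0r.
  by have [->|->] := ord2_cases k.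
have [j0 [z00 z01]] := orth2_triple_zero (rows 0).
have [j1 [z10 z11]] := orth2_triple_zero (rows 1).
have Nn j : N j != 0 by exact: Uinj.
have j01 : j0 != j1.
  apply: contraNneq (Nn j0) => E01; rewrite -E01 in z10 z11.
  by apply/eqP; apply: (@matrix2_eq0 _ 0 1).
have [k /andP[k0 k1]] := ord3_third j0 j1.
exists k; have unU := norm_det_unitary UU'.
have detU X : `|\det (U *m X)| = `|\det X| by rewrite det_mulmx normrM unU mul1r.
rewrite -(detU (M k)) -(detU W) -(hs_unitary _ _ UU).
have row0 X : hs (N j1) X = 0 -> (N j1 0 0)^* * X 0 0 + (N j1 0 1)^* * X 0 1 = 0.
  by rewrite hsE /rowip z10 z11 conjC0 !mul0r !addr0.
have row1 X : hs (N j0) X = 0 -> (N j0 1 0)^* * X 1 0 + (N j0 1 1)^* * X 1 1 = 0.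
  by rewrite hsE /rowip z00 z01 conjC0 !mul0r !add0r.
have hsC (X Y : 'M[C]_2) : hs X Y = 0 -> hs Y X = 0.
  rewrite !hsE /rowip => /(congr1 (fun z : C => z^*)); rewrite conjC0 => <-.
  by rewrite !(rmorphD, rmorphM) /= !conjCK; ring.
(* Row 0 of [U *m M k] and of [U *m W] is orthogonal to row 0 of [N j1], whose row 1 vanishes;
   likewise row 1 and [N j0]. *)
apply: (@det_orth_pair _ (fun b => N j1 0 b) (fun b => N j0 1 b)).
- apply: contraNT (Nn j1); rewrite negb_or !negbK => /andP[/eqP a /eqP b].
  by apply/eqP; apply: (@matrix2_eq0 _ 0 1).
- apply: contraNT (Nn j0); rewrite negb_or !negbK => /andP[/eqP a /eqP b].
  by apply/eqP; apply: (@matrix2_eq0 _ 0 1).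
- by apply: row0; rewrite (hs_unitary _ _ UU) orthM // eq_sym.
- by apply: row1; rewrite (hs_unitary _ _ UU) orthM // eq_sym.
- by apply: row0; rewrite (hs_unitary _ _ UU); apply: hsC.
- by apply: row1; rewrite (hs_unitary _ _ UU); apply: hsC.
- by rewrite (hs_unitary _ _ UU).
- by rewrite (hs_unitary _ _ UU).
Qed.

(** Coefficient matrix of a two-qubit vector: product vectors have rank at most one, and for unit
    vectors twice the modulus of the determinant is the concurrence. *)
Definition mx_of (v : 'cV[C]_(2 * 2)) : 'M[C]_2 :=
  \matrix_(a, b) v (pair_idx a b) 0.

Lemma mx_of_kron (E F : 'M[C]_2) v :
  mx_of (kronmx E F *m v) = E *m mx_of v *m F^T.
Proof.
apply/matrixP => a b; rewrite !mxE big_pair_idx exchange_big /=.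
apply: eq_bigr => d _; rewrite !mxE mulr_suml; apply: eq_bigr => c _.
by rewrite !mxE !pair_idx1 !pair_idx2 mulrAC.
Qed.

Lemma braket_mx_of u v : braket u v = hs (mx_of u) (mx_of v).
Proof. by rewrite braketE big_pair_idx !sum_ord2 hsE /rowip !mxE. Qed.

Lemma hs_tr (X Y : 'M[C]_2) : hs X^T Y^T = hs X Y.
Proof. by rewrite !hsE /rowip !mxE; ring. Qed.

Lemma braket_kron1 (E : 'M[C]_2) u v :
  braket u (kronmx E 1%:M *m v) = hs (mx_of u) (E *m mx_of v).
Proof. by rewrite braket_mx_of mx_of_kron trmx1 mulmx1. Qed.

Lemma braket_1kron (E : 'M[C]_2) u v :
  braket u (kronmx 1%:M E *m v) = hs (mx_of u)^T (E *m (mx_of v)^T).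
Proof. by rewrite braket_mx_of mx_of_kron mul1mx -hs_tr trmx_mul trmxK. Qed.

Lemma braket_mx_of_tr u v : braket u v = hs (mx_of u)^T (mx_of v)^T.
Proof. by rewrite hs_tr braket_mx_of. Qed.

Lemma mx_of_eq0 v : (mx_of v == 0) = (v == 0).
Proof.
apply/eqP/eqP => [/matrixP v0|->]; last by apply/matrixP => a b; rewrite !mxE.
apply/matrixP => i j; rewrite ord1 -[i]pair_idxK.
by have := v0 (kron_idx1 i) (kron_idx2 i); rewrite !mxE.
Qed.

(** A measurement by Bob becomes one by Alice after transposing all coefficient matrices. *)
Lemma local_split_det (u : 'I_3 -> 'cV[C]_(2 * 2)) (Phi : 'cV[C]_(2 * 2)) (E : 'M[C]_2) :
  E^t* = E -> ~~ is_scalar_mx E -> (forall i, u i != 0) ->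
  preserves_orth u 1%:M -> (forall i, braket Phi (u i) = 0) -> braket Phi Phi = 1 ->
  preserves_orth u (kronmx E 1%:M) \/ preserves_orth u (kronmx 1%:M E) ->
  exists k, `|\det (mx_of (u k))| ^+ 2
    = `|\det (mx_of Phi)| ^+ 2 * braket (u k) (u k) ^+ 2.
Proof.
move=> herm ns u0 orth perp unit [] pres.
  have [|||||k kE] := @orthogonal_split_det (fun i => mx_of (u i)) (mx_of Phi) E herm ns.
  - by move=> i; rewrite mx_of_eq0.
  - by move=> i j ij; rewrite -braket_mx_of -[u j]mul1mx orth.
  - by move=> i j ij; rewrite -braket_kron1 pres.
  - by move=> i; rewrite -braket_mx_of.
  - by rewrite -braket_mx_of.
  by exists k; rewrite kE -braket_mx_of.
have [|||||k kE] := @orthogonal_split_det (fun i => (mx_of (u i))^T) (mx_of Phi)^T E herm ns.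
- by move=> i; rewrite trmx_eq0 mx_of_eq0.
- by move=> i j ij; rewrite -braket_mx_of_tr -[u j]mul1mx orth.
- by move=> i j ij; rewrite -braket_1kron pres.
- by move=> i; rewrite -braket_mx_of_tr.
- by rewrite -braket_mx_of_tr.
by exists k; rewrite !det_tr in kE; rewrite kE -braket_mx_of_tr.
Qed.

(** * Product vectors, Schmidt coefficients and determinants *)

Lemma mx_of_prod (a b : 'cV[C]_2) i j :
  mx_of (kronmx a b) i j = a i 0 * b j 0.
Proof. by rewrite !mxE pair_idx1 pair_idx2 !ord1. Qed.

(** Hadamard's inequality in size 2; the defect is the squared modulus of the inner product of the
    rows. *)
Lemma norm_det2_le (x y z t : C) :
  `|x * t - y * z| ^+ 2 <= (`|x| ^+ 2 + `|y| ^+ 2) * (`|z| ^+ 2 + `|t| ^+ 2).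
Proof.
rewrite -subr_ge0 (_ : _ - _ = `|x * z^* + y * t^*| ^+ 2) ?exprn_ge0 //.
by rewrite !normCK !(rmorphB, rmorphD, rmorphM) /= !conjCK; ring.
Qed.

(* Rotating [a] and [b] to basis vectors turns the overlap into the entry [x]
   of a matrix with the same determinant and norm. *)
Lemma product_overlap_det (a b : 'cV[C]_2) v :
  braket (kronmx a b : 'cV_(2 * 2)) (kronmx a b) = 1 ->
  `|\det (mx_of v)| ^+ 2
    <= braket v v * (braket v v - `|braket (kronmx a b : 'cV_(2 * 2)) v| ^+ 2).
Proof.
rewrite !braket_mx_of !hsE /rowip det2E !mx_of_prod.
move: (a 0 0) (a 1 0) (b 0 0) (b 1 0) (mx_of v 0 0) (mx_of v 0 1) (mx_of v 1 0)
  (mx_of v 1 1) => a0 a1 b0 b1 p q r s.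
rewrite !rmorphM /= => unit.
pose x := a0^* * b0^* * p + a0^* * b1^* * q + (a1^* * b0^* * r + a1^* * b1^* * s).
rewrite -/x.
(* [y], [z] and [t] are the other entries of the rotated matrix. Only the product of the norms of
   [a] and [b] is known to be 1, which [XY1] records. *)
pose y := a0^* * (q * b0 - p * b1) + a1^* * (s * b0 - r * b1).
pose z := a0 * (r * b0^* + s * b1^*) - a1 * (p * b0^* + q * b1^*).
pose t := a0 * (s * b0 - r * b1) - a1 * (q * b0 - p * b1).
pose XY := (a0 * a0^* + a1 * a1^*) * (b0 * b0^* + b1 * b1^*).
have XY1 : XY = 1 by rewrite /XY -unit; ring.
have -> : p * s - q * r = x * t - y * z.
  by rewrite -[LHS]mul1r -XY1 /XY /x /y /z /t; ring.
set m := _ + (_ + _); have mE : m = `|x| ^+ 2 + `|y| ^+ 2 + (`|z| ^+ 2 + `|t| ^+ 2).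
  rewrite -[LHS]mul1r -XY1 /XY /m /x /y /z /t !normCK.
  by rewrite !(rmorphB, rmorphD, rmorphM) /= !conjCK; ring.
apply: le_trans (norm_det2_le _ _ _ _) _.
have n0 (w : C) : 0 <= `|w| ^+ 2 by rewrite exprn_ge0.
apply: ler_pM; rewrite ?addr_ge0 //; first by rewrite mE lerDl addr_ge0.
by rewrite mE -subr_ge0 (_ : _ - _ = `|y| ^+ 2) //; ring.
Qed.

(** The Schmidt decomposition is a singular value decomposition of [mx_of Phi], with unitary [A] and
    [B]. *)
Lemma schmidt_det (Phi : 'cV[C]_(2 * 2)) s : braket Phi Phi = 1 ->
  schmidt_decomp Phi s ->
  s 0 ^+ 2 + s 1 ^+ 2 = 1 /\ `|\det (mx_of Phi)| ^+ 2 = s 0 ^+ 2 * s 1 ^+ 2.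
Proof.
move=> unit [e [f [eo [fo [s0 defPhi]]]]].
pose A := \matrix_(a, k) e k a 0; pose B := \matrix_(k, b) f k b 0.
have AA : A^t* *m A = 1%:M.
  apply/matrixP => k l; rewrite !mxE -eo braketE.
  by apply: eq_bigr => a _; rewrite !mxE.
have BB : B *m B^t* = 1%:M.
  apply/matrixP => k l; rewrite !mxE eq_sym -fo braketE.
  by apply: eq_bigr => a _; rewrite !mxE mulrC.
pose S := diag_mx (\row_k s k).
have PhiE : mx_of Phi = A *m S *m B.
  apply/matrixP => a b; rewrite defPhi /S mul_mx_diag !mxE sum_ord2 !sum_ord2 !mxE.
  by rewrite !pair_idx1 !pair_idx2 !ord1; ring.
have detS : \det S = s 0 * s 1.
  by rewrite det_diag big_ord_recl big_ord1 !mxE; congr (_ * s _); apply: val_inj.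
have [r0 r1] : (s 0)^* = s 0 /\ (s 1)^* = s 1 by rewrite !geC0_conj.
split.
  rewrite -unit braket_mx_of PhiE -mulmxA hs_unitary // -hs_tr !trmx_mul.
  have BB' : (B^T)^t* *m B^T = 1%:M.
    by have := congr1 trmx BB; rewrite trmx_mul trmx1 map_trmx.
  rewrite hs_unitary //.
  by rewrite hsE /rowip !mxE /= !mulr1n !mulr0n !conjC0 r0 r1; ring.
rewrite PhiE !det_mulmx !normrM (norm_det_unitary BB) mulr1.
rewrite (norm_det_unitary (mulmx1C AA)) mul1r detS normCK rmorphM /= r0 r1; ring.
Qed.
End OrthogonalBases.

Theorem theorem2 (C : numClosedFieldType)
  (alpha beta : 'I_3 -> 'cV[C]_2) (p : 'I_3 -> C)
  (Phi : 'cV[C]_(2 * 2)) (s : 'I_2 -> C) (lam : C) :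
  let psi := fun l => kronmx (alpha l) (beta l) in
  (* ensemble of normalized product states with positive prior probabilities *)
  (forall l, braket (psi l) (psi l) = 1) ->
  (forall l, 0 < p l) -> \sum_(l < 3) p l = 1 ->
  (* linear independence *)
  row_free (\matrix_(l < 3, k < 2 * 2) psi l k 0) ->
  (* Phi is a unit vector and span{psi_l} = {Phi}^perp *)
  braket Phi Phi = 1 ->
  (forall v : 'cV[C]_(2 * 2),
     (v^T <= \matrix_(l < 3, k < 2 * 2) psi l k 0)%MS <-> braket Phi v = 0) ->
  (* lam = lambda_min(Phi), the smallest squared Schmidt coefficient *)
  schmidt_decomp Phi s -> lam = Num.min (s 0 ^+ 2) (s 1 ^+ 2) ->
  (forall i j k : 'I_3, i != j -> i != k -> j != k ->
     p j ^+ 2 * `|braket (psi i) (psi j)| ^+ 2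
       + p k ^+ 2 * `|braket (psi i) (psi k)| ^+ 2
     < p i ^+ 2 * lam ^+ 2) ->
  ~ (exists P : 'I_3 -> 'M[C]_(2 * 2), is_locc_povm P /\ optimal_povm p psi P).
Proof.
move=> psi unit p0 psum indep unitPhi span schmidt lamE small [P [[D [t [D2 [wf tP]]]] optP]].
have [s01 detPhi] := schmidt_det unitPhi schmidt.
have [_ [_ [_ [_ [s_ge0 _]]]]] := schmidt.
have sr : forall k, s k ^+ 2 \is Num.real by move=> k; rewrite ger0_real ?exprn_ge0.
(* The squared coefficients sum to 1, so the larger one is [1 - lam]. *)
have [lam0 lam_half lamD] : [/\ 0 <= lam, lam <= 1 - lam
    & lam * (1 - lam) = s 0 ^+ 2 * s 1 ^+ 2].
  rewrite lamE /Num.min -s01; case: (real_ltP (sr 0) (sr 1)) => [lt01|le10].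
    by rewrite [_ + _ - _]addrAC subrr add0r exprn_ge0 // ltW.
  by rewrite addrK exprn_ge0 // mulrC.
have gap i : 1 - braket (psi i) (P i *m psi i) < lam ^+ 2.
  have : exists j k : 'I_3, [/\ i != j, i != k & j != k].
    case: i => [[|[|[|?]]] ?] //; [exists 1, (lift 0 1)|exists 0, (lift 0 1)|exists 0, 1];
      by split.
  case=> j [k [ij ik jk]]; apply: (optimal_detection_gt ij ik jk unit p0 optP).
  exact: small.
(* Since [lam ^+ 2 <= 1], [gap] makes every detection probability positive, so no [u i] vanishes. *)
have lam1 : lam <= 1 by rewrite (le_trans lam_half) // gerBl.
have g0 i : 0 < braket (psi i) (P i *m psi i).
  have := lt_le_trans (gap i) (exprn_ile1 2 lam0 lam1).
  by rewrite ltrBlDr ltrDl.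
have gn i : braket (psi i) (P i *m psi i) != 0 by rewrite gt_eqF.
pose u i := P i *m psi i.
have uu i : braket (u i) (u i) = braket (psi i) (u i).
  by rewrite (optimal_basis_orth p0 optP indep) eqxx.
have u0 i : u i != 0 by rewrite -braket_eq0 uu.
have disc : discriminates u (locc_effect t 1%:M 1%:M).
  move=> i j ij; have -> : locc_effect t 1%:M 1%:M i = P i by rewrite -tP.
  exact: (optimal_basis_povm p0 optP indep span gn).
have le1 := local_effect1 C D2.
have sc1 : is_scalar_mx (local_effect (1%:M : 'M[C]_D)) by rewrite le1 scalar_mx_is_scalar.
have nz1 : local_effect (1%:M : 'M[C]_D) != 0 by rewrite le1 matrix_nonzero1.
have other (k : 'I_3) : exists j, j != k.
  by have [j /andP[jk _]] := ord3_third k k; exists j.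
have [E [nsE adjE pres]] := locc_local_split wf other u0 disc sc1 nz1 sc1 nz1.
have orth1 : preserves_orth u 1%:M.
  move=> i j ij; rewrite mul1mx (optimal_basis_orth p0 optP indep).
  by rewrite (negPf ij).
have perp i : braket Phi (u i) = 0 by exact: (optimal_basis_perp p0 optP indep span).
have [k detk] := local_split_det adjE nsE u0 orth1 perp unitPhi pres.
(* [u k] has squared norm [g] and overlap [g] with [psi k]; after cancelling [g ^+ 2] the bound
   reads [lam * (1 - lam) <= 1 - g < lam ^+ 2], against [lam <= 1 - lam]. *)
have := product_overlap_det (u k) (unit k).
rewrite detk detPhi -lamD -/(psi k) uu; set g := braket _ _.
have gk : 0 < g by exact: g0.
rewrite ger0_norm ?(ltW gk) // (_ : g * _ = g ^+ 2 * (1 - g)); last by ring.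
rewrite mulrC ler_pM2l ?exprn_gt0 // => /le_lt_trans/(_ (gap k)).
by move=> /lt_geF/negbT/negP; apply; rewrite expr2 ler_wpM2l.
Qed.
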